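(* Let $f\in\mathcal{B}$. Suppose that $f$ has finitely many tracts and regular logarithmic transform. Let $R_0\geq 1$ with $\overline{\mathrm{sing}(f^{-1})}\cup\{f(0)\}\subset D(0,R_0)$, let $F\colon W_{R_0}\to\mathbb{H}_{>\log R_0}$ be the logarithmic transform of $f$, and let $\beta>0$ be such that $|F'(w)|\geq\beta|F(w)|$ for all $w\in W_{R_0}\cap\mathbb{H}_{>\log R_0}$. Let $N$ be the number of tracts of $f$, let $R=\max\{R_0,\exp(4/\beta)\}$ and let $1<t\leq 2$. If $$M\geq\max\left\{e^{5\pi}R,\ \exp\left(\left(\frac{10\cdot 4^t\cdot N}{(t-1)\cdot\beta^t}\right)^{1/(t-1)}\right)\right\},$$ then $$\dim\left(J_{\geq M}(f)\setminus I(f)\right)\leq t .$$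
   Context: $\dim$ denotes Hausdorff dimension. For a transcendental entire function $f$, the Fatou set $F(f)$ is the set of points of $\mathbb{C}$ at which the iterates $f^n$ form a normal family, the Julia set is $J(f)=\mathbb{C}\setminus F(f)$, and the escaping set is $I(f)=\{z\in\mathbb{C}: |f^n(z)|\to\infty \text{ as } n\to\infty\}$. For $M>0$, $J_{\geq M}(f)=\{z\in J(f): |f^n(z)|\geq M\text{ for all } n\geq 0\}$. The set $\mathrm{sing}(f^{-1})$ consists of the critical values and the finite asymptotic values of $f$. The Eremenko--Lyubich class $\mathcal{B}$ consists of all transcendental entire functions $f$ for which $\mathrm{sing}(f^{-1})$ is bounded. Notation: $D(a,r)=\{z:|z-a|<r\}$, $\Delta_r=\{z:|z|>r\}$, $\mathbb{H}_{>r}=\{z:\operatorname{Re} z>r\}$. Let $f\in\mathcal{B}$ and let $S>|f(0)|$ with $\overline{\mathrm{sing}(f^{-1})}\subset D(0,S)$. Put $V_S=f^{-1}(\Delta_S)$ and $W_S=\exp^{-1}(V_S)=\{w: e^w\in V_S\}$. The connected components of $V_S$ are called the tracts of $f$ (their number does not depend on the choice of such $S$). There exists a $2\pi i$-periodic holomorphic function $F\colon W_S\to\mathbb{H}_{>\log S}$ which maps every connected component of $W_S$ biholomorphically onto $\mathbb{H}_{>\log S}$ and satisfies $\exp F(w)=f(\exp w)$ for $w\in W_S$; it is called the logarithmic transform of $f$. The function $f$ is said to have regular logarithmic transform if there exist $\beta,\rho>0$ such that $|F'(w)|\geq\beta|F(w)|$ for all $w\in W_S\cap\mathbb{H}_{>\rho}$.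 *)

(* Defs.v *)
From HB Require Import structures.
From mathcomp Require Import all_boot all_order all_algebra.
From mathcomp Require Import all_classical all_reals all_analysis.
From mathcomp Require Import complex.

Set Implicit Arguments.
Unset Strict Implicit.
Unset Printing Implicit Defensive.

Import Order.TTheory GRing.Theory Num.Theory.
Import numFieldNormedType.Exports.

Local Open Scope classical_set_scope.
Local Open Scope ring_scope.
Local Open Scope complex_scope.

(* The topology, metric and normed structures of the numField R[i], seen as a
   one-dimensional normed space over itself: in particular [derivable f z 1]
   and [derive1 f] below are complex differentiability and the complex derivative. *)
HB.instance Definition _ (R : rcfType) := NormedModule.copy R[i] R[i]^o.

(* [`|z|] has values in R[i]; [cabs z] is the same modulus with values in R. *)
Notation cabs := (@ComplexField.Normc.normc _).

Section ComplexPlane.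
Context {R : realType}.
Local Notation C := R[i].
Implicit Types (U V : set C) (f g : C -> C).

Definition cexp (z : C) : C :=
  (expR (complex.Re z))%:C * (cos (complex.Im z) +i* sin (complex.Im z)).

Definition disc (a : C) (r : R) : set C := [set z | cabs (z - a) < r].

Definition ext_disc (r : R) : set C := [set z | r < cabs z].

Definition half_plane (r : R) : set C := [set z | r < complex.Re z].

(* Meant for open U. *)
Definition holomorphic_on U f := forall z, U z -> derivable f z 1.

Definition biholomorphic U V f :=
  [/\ holomorphic_on U f, set_bij U V f &
    exists g, [/\ holomorphic_on V g, {homo g : z / V z >-> U z},
      forall z, U z -> g (f z) = z & forall z, V z -> f (g z) = z]].

Definition entire f := holomorphic_on setT f.

Definition transcendental_entire f :=
  entire f /\ ~ exists p : {poly C}, forall z, f z = p.[z].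

Definition components U : set (set C) := [set connected_component U z | z in U].

End ComplexPlane.

Section HausdorffDimension.
Context {R : realType}.
Local Notation C := R[i].
Implicit Types (A : set C) (s d : R).
Local Open Scope ereal_scope.

(* [-oo] on the empty set. *)
Definition diameter A : \bar R :=
  ereal_sup [set (cabs (x - y)%R)%:E | x in A & y in A].

Definition diameter_pow s A : \bar R :=
  if A == set0 then 0 else diameter A `^ s.

Definition hausdorff_premeasure s d A : \bar R :=
  ereal_inf [set \sum_(0 <= k <oo) diameter_pow s (U k) | U in
    [set U : nat -> set C |
      A `<=` \bigcup_k U k /\ forall k, diameter (U k) <= d%:E]].

Definition hausdorff_measure s A : \bar R :=
  ereal_sup [set hausdorff_premeasure s d A | d in [set d | (0 < d)%R]].

Definition hausdorff_dim A : \bar R :=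
  ereal_inf [set s%:E | s in [set s | (0 <= s)%R /\ hausdorff_measure s A = 0]].

End HausdorffDimension.

Section Dynamics.
Context {R : realType}.
Local Notation C := R[i].
Local Notation sphere := (one_point_compactification C).
Implicit Types (U : set C) (f : C -> C).

(* The chordal metric of the Riemann sphere; [None] is the point at infinity. *)
Definition chordal (x y : sphere) : R :=
  match x, y with
  | Some z, Some w => 2 * cabs (z - w) /
      (Num.sqrt (1 + cabs z ^+ 2) * Num.sqrt (1 + cabs w ^+ 2))
  | Some z, None | None, Some z => 2 / Num.sqrt (1 + cabs z ^+ 2)
  | None, None => 0
  end.

Definition spherically_locally_uniform_cvg U (u : nat -> C -> C)
    (g : C -> sphere) :=
  forall z, U z -> exists2 V, nbhs z V &
    forall e : R, 0 < e -> \forall n \near \oo,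
      forall w, V w -> U w -> chordal (Some (u n w)) (g w) < e.

Definition normal_family U (G : set (C -> C)) :=
  forall u : nat -> C -> C, (forall n, G (u n)) ->
    exists2 phi : nat -> nat, {homo phi : m n / (m < n)%N} &
      exists g, spherically_locally_uniform_cvg U (u \o phi) g.

Definition fatou_set f : set C :=
  [set z | exists2 U, open_nbhs z U & normal_family U (range (fun n => iter n f))].

Definition julia_set f : set C := ~` fatou_set f.

Definition julia_ge f (M : R) : set C :=
  [set z | julia_set f z /\ forall n, M <= cabs (iter n f z)].

Definition escaping_set f : set C :=
  [set z | cabs (iter n f z) @[n --> \oo] --> +oo].

Definition critical_values f : set C :=
  [set f z | z in [set z | derive1 f z = 0]].

Definition asymptotic_values f : set C :=
  [set a | exists gamma : R -> C,
    [/\ {within `[0, +oo[, continuous gamma},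
        cabs (gamma t) @[t --> +oo] --> +oo
      & f (gamma t) @[t --> +oo] --> a]].

Definition sing_inv f : set C := critical_values f `|` asymptotic_values f.

Definition class_B f := transcendental_entire f /\ bounded_set (sing_inv f).

End Dynamics.

Section LogarithmicTransform.
Context {R : realType}.
Local Notation C := R[i].
Implicit Types (f F : C -> C) (S beta rho : R).

Definition admissible_radius f S :=
  closure (sing_inv f) `|` [set f 0] `<=` disc 0 S.

Definition tract_domain f S : set C := f @^-1` ext_disc S.

Definition tracts f S : set (set C) := components (tract_domain f S).

Definition log_domain f S : set C := cexp @^-1` tract_domain f S.

(* The values of F outside [log_domain f S] are irrelevant. *)
Definition logarithmic_transform f S F :=
  [/\ holomorphic_on (log_domain f S) F,
      forall w, log_domain f S w -> F (w + (2 * pi) *i) = F w,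
      forall W, components (log_domain f S) W ->
        biholomorphic W (half_plane (ln S)) F
    & forall w, log_domain f S w -> cexp (F w) = f (cexp w)].

Definition derivative_bound f S F beta rho :=
  forall w, log_domain f S w -> half_plane rho w ->
    beta * cabs (F w) <= cabs (derive1 F w).

Definition regular_logarithmic_transform f :=
  exists S F, [/\ admissible_radius f S, logarithmic_transform f S F
    & exists beta rho, [/\ 0 < beta, 0 < rho & derivative_bound f S F beta rho]].

End LogarithmicTransform.

(* Main.v *)
Require Import Defs.
From HB Require Import structures.
From mathcomp Require Import all_boot all_order all_algebra.
From mathcomp Require Import all_classical all_reals all_analysis.
From mathcomp Require Import complex ring lra.

(** In logarithmic coordinates the map f becomes F, and an orbit of f outside the
    disc of radius M becomes an orbit of F with real parts at least y = ln M. The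
    inverse branches of F are those of N logarithmic components (one for each tract,
    enum_log_components) precomposed with the translations by 2 pi i k. At a point of
    real part x the branch with index k has derivative at most 1 / (beta |z + 2 pi i k|),
    hence the t-th powers of the contraction factors of all branches have a sum of
    order N beta^-t x^(1 - t) / (t - 1), which converges as t > 1. The lower bound for
    M makes this sum at most 1/2 (nneseries_powRN_le, branch_sum_le).

    Consequently, covers improve under pullback. A ball of radius r <= 1 in the
    logarithmic plane that meets the orbits considered has a preimage contained in
    countably many such balls, whose radii r_j satisfy
    sum r_j^t <= r^t / 2 (covered_preimage_ball), so the n-th preimages have total
    weight at most 2^-n r^t. That a preimage lies again in a ball comes from following one
    inverse branch along a segment: the lower bound for |F'| shows at once that the
    branch is a contraction and that it does not leave the half-plane where the bound is
    known (inverse_branch_lipschitz).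

    A point which does not escape returns infinitely often to some annulus
    M <= |z| <= K. That annulus is covered by the exponential images of finitely many
    balls, so for every m the points in question lie in the union of the n-th preimages
    of these balls with n >= m. The total weight of these is a tail of a
    geometric series, and it bounds the sum of the t-th powers of the diameters up to a
    constant on each bounded set. The t-dimensional Hausdorff measure is therefore zero
    (hausdorff_null_returns), also after the countable union over K. *)

Set Implicit Arguments.
Unset Strict Implicit.
Unset Printing Implicit Defensive.

Import Order.TTheory GRing.Theory Num.Theory.
Import numFieldNormedType.Exports.

Local Open Scope classical_set_scope.
Local Open Scope ring_scope.

(** * Weighted countable covers *)

Section Covers.
Context {R : realType} {T : Type}.
Implicit Types (P Q : set T -> \bar R -> Prop) (X : set T).
Local Open Scope ereal_scope.

(** A cover is a sequence of sets, each carrying a weight that the predicate P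
    permits for it. Keeping P abstract lets the same bookkeeping serve covers by
    exponential images of balls (during the pullback) and covers weighted by a
    power of the diameter (for Hausdorff measure). *)
Definition covered P X (s : \bar R) :=
  exists (U : nat -> set T) (v : nat -> \bar R),
    [/\ X `<=` \bigcup_k U k, forall k, 0 <= v k /\ P (U k) (v k)
      & \sum_(0 <= k <oo) v k <= s].

Lemma sub_covered P X Y s s' :
  Y `<=` X -> s <= s' -> covered P X s -> covered P Y s'.
Proof.
move=> YX ss' [U [v [XU vP vs]]]; exists U, v; split=> //.
  exact: subset_trans XU.
exact: le_trans ss'.
Qed.

Lemma covered_bigcup P X (Y : nat -> set T) (s : nat -> \bar R) :
    X `<=` \bigcup_n Y n -> (forall n, covered P (Y n) (s n)) ->
  covered P X (\sum_(0 <= n <oo) s n).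
Proof.
move=> XY /choice[U /choice[v Uv]].
have v0 n k : 0 <= v n k by have [_ /(_ k)[]] := Uv n.
have /card_set_bijP[e e_bij] : ([set: nat] #= [set: nat * nat])%card.
  by rewrite card_eq_sym; exact: card_nat2.
exists (fun m => U (e m).1 (e m).2), (fun m => v (e m).1 (e m).2); split.
- move=> x /XY[n _ Ynx]; have [/(_ _ Ynx)[k _ Uknx] _ _] := Uv n.
  by have [_ _ /(_ (n, k) I)[m _ em]] := e_bij; exists m; rewrite // em.
- by move=> m; split=> //; have [_ /(_ (e m).2)[]] := Uv (e m).1.
- rewrite nneseries_esumT// -(reindex_esum [set: nat] [set: nat * nat] e
    (fun nk => v nk.1 nk.2))//.
  have -> : [set: nat * nat] = [set: nat] `*`` (fun=> [set: nat]) by apply/seteqP; split=> -[].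
  rewrite -(@esum_esum R nat nat _ _ v)// -nneseries_esumT; last first.
    by move=> n; apply: esum_ge0.
  apply: lee_nneseries => [n _ _|n _]; first exact: esum_ge0.
  by have [_ _] := Uv n; rewrite nneseries_esumT.
Qed.

Lemma covered_bigcup_ord P X (n : nat) (Y : nat -> set T) (s : \bar R) :
    0 <= s -> P set0 0 ->
    X `<=` \bigcup_(i < n) Y i -> (forall i, (i < n)%N -> covered P (Y i) s) ->
  covered P X (n%:R%:E * s).
Proof.
move=> s0 P0 XY Ys.
pose Z i := if (i < n)%N then Y i else set0.
pose a i := if (i < n)%N then s else 0.
have a0 i : 0 <= a i by rewrite /a; case: ifP.
have -> : n%:R%:E * s = \sum_(0 <= i <oo) a i.
  rewrite (@nneseries_split R a 0 n)// add0n eseries0 ?adde0; last first.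
    by move=> i ni _; rewrite /a ltnNge ni.
  rewrite big_mkord (eq_bigr (fun=> s)); last by move=> i _; rewrite /a ltn_ord.
  by rewrite sumr_const card_ord mule_natl.
apply: (@covered_bigcup _ _ Z) => [x /XY[i /= ni Yix]|i].
  by exists i => //; rewrite /Z ni.
rewrite /Z /a; case: ifP => [/Ys//|_].
exists (fun=> set0), (fun=> 0); split=> //.
by rewrite eseries0.
Qed.

(** One refinement step: if a P-set of weight v always pulls back under g to
    something of Q-cost at most q v, then a whole P-cover of cost s pulls back to
    a Q-cover of cost q s. Iterating it with q < 1 gives geometric decay. *)
Lemma covered_preimage P Q X Y (g : T -> T) (q : R) s :
    (0 <= q)%R ->
    (forall U v, 0 <= v -> P U v -> covered Q (Y `&` g @^-1` U) (q%:E * v)) ->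
  covered P X s -> covered Q (Y `&` g @^-1` X) (q%:E * s).
Proof.
move=> q0 PQ [U [v [XU vP vs]]].
apply: (@sub_covered _ (Y `&` g @^-1` X) _ (\sum_(0 <= k <oo) q%:E * v k)) => //.
  rewrite nneseriesZl//; first by apply: lee_wpmul2l.
  by move=> k _; have [] := vP k.
apply: (@covered_bigcup _ _ (fun k => Y `&` g @^-1` U k)) => [x [Yx /XU[k _ Ukx]]|k].
  by exists k.
by have [] := vP k; exact: PQ.
Qed.

Lemma covered1 P X s : 0 <= s -> P X s -> P set0 0 -> covered P X s.
Proof.
move=> s0 Ps P0.
exists (fun k => if k is 0%N then X else set0), (fun k => if k is 0%N then s else 0).
split=> [x Xx|[|k]//|]; first by exists 0%N.
rewrite (@nneseries_split R _ 0 1)//; last by case.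
by rewrite add0n big_nat1 eseries0 ?adde0//; case.
Qed.

End Covers.

(** * Sets of zero Hausdorff measure *)

Section HausdorffNull.
Context {R : realType}.
Local Notation C := R[i].
Implicit Types (A U : set C) (t : R).
Local Open Scope ereal_scope.

Definition diam_weight t U (v : \bar R) := diameter_pow t U <= v.

(** Vanishing of the t-dimensional Hausdorff content. A small total weight forces
    every diameter to be small, so that this already gives Hausdorff measure zero. *)
Definition hausdorff_null t A :=
  forall e : R, (0 < e)%R -> covered (diam_weight t) A e%:E.

Lemma diameter_pow_ge0 t U : 0 <= diameter_pow t U.
Proof. by rewrite /diameter_pow; case: ifP => // _; exact: poweR_ge0. Qed.

Lemma sub_hausdorff_null t A B :
  B `<=` A -> hausdorff_null t A -> hausdorff_null t B.
Proof. by move=> BA A0 e e0; apply: sub_covered (A0 e e0). Qed.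

Lemma hausdorff_null_bigcup t (A : nat -> set C) :
  (forall n, hausdorff_null t (A n)) -> hausdorff_null t (\bigcup_n A n).
Proof.
move=> A0 e e0.
have An n : covered (diam_weight t) (A n) (e / (2 ^ n.+1)%:R)%:E.
  by apply: A0; rewrite divr_gt0// ltr0n expn_gt0.
apply: sub_covered (covered_bigcup (fun x Ax => Ax) An) => //.
exact: epsilon_trick0 (ltW e0).
Qed.

(** The reason why small weight implies small mesh. *)
Lemma diameter_le_of_pow t (d : R) U : (0 < t)%R -> (0 < d)%R ->
  diameter_pow t U <= (d `^ t)%:E -> diameter U <= d%:E.
Proof.
move=> t0 d0; rewrite /diameter_pow; case: eqP => [-> _|U0].
  by apply: ge_ereal_sup => _ [x []].
move=> dUt; rewrite leNgt; apply/negP => ltdU; move: dUt; apply/negP.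
rewrite -ltNge; case: (diameter U) ltdU => [r| |//].
  rewrite lte_fin => dr; rewrite poweR_EFin lte_fin.
  by rewrite gt0_ltr_powR ?nnegrE ?(ltW d0)// ltW// (lt_trans d0).
by rewrite poweRyr ?gt_eqF// => _; rewrite ltry.
Qed.

Lemma diameter_pow_le t (d : R) U : (0 <= t)%R ->
  diameter U <= d%:E -> diameter_pow t U <= (d `^ t)%:E.
Proof.
move=> t0; rewrite /diameter_pow; case: eqP => [_ _|/eqP/set0P[x Ux]].
  by rewrite lee_fin powR_ge0.
have : 0 <= diameter U.
  apply: le_ereal_sup_tmp; exists (cabs (x - x))%:E; first by exists x => //; exists x.
  by rewrite subrr ComplexField.Normc.normc0.
case: (diameter U) => [r| |//]; last by rewrite leye_eq.
rewrite !lee_fin => r0 rd.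
by apply: ge0_ler_powR; rewrite ?nnegrE// (le_trans r0).
Qed.

Lemma hausdorff_dim_le t A :
  (0 < t)%R -> hausdorff_null t A -> hausdorff_dim A <= t%:E.
Proof.
move=> t0 A0; apply: ereal_inf_lbound; exists t => //; split; first exact: ltW.
apply/eqP; rewrite eq_le; apply/andP; split; last first.
  apply: le_ereal_sup_tmp; exists (hausdorff_premeasure t 1%R A).
    by exists 1%R => //=; exact: ltr01.
  apply/ereal_infP => _ [U _ <-]; apply: nneseries_ge0 => k _ _.
  exact: diameter_pow_ge0.
apply/ereal_supP => _ [d /= d0 <-]; apply/lee_addgt0Pr => e e0; rewrite add0e.
have m0 : (0 < Num.min e (d `^ t))%R by rewrite lt_min e0 powR_gt0.
have [U [v [AU vU vm]]] := A0 _ m0.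
have Uv : \sum_(0 <= k <oo) diameter_pow t (U k) <= (Num.min e (d `^ t))%:E.
  apply: le_trans vm; apply: lee_nneseries => [k _ _|k _].
    exact: diameter_pow_ge0.
  by have [] := vU k.
apply: (le_trans (y := \sum_(0 <= k <oo) diameter_pow t (U k))); last first.
  by apply: le_trans Uv _; rewrite lee_fin ge_min lexx.
apply: ereal_inf_lbound; exists U => //; split=> // k.
apply: (diameter_le_of_pow t0 d0).
apply: (le_trans (y := (Num.min e (d `^ t))%:E)); last first.
  by rewrite lee_fin ge_min lexx orbT.
apply: le_trans Uv; rewrite (nneseriesD1 (n := k))//; last first.
  by move=> n _; exact: diameter_pow_ge0.
by rewrite leeDl// nneseries_ge0// => n _ _; exact: diameter_pow_ge0.
Qed.

End HausdorffNull.

(** * The plane with real-valued modulus *)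

Section Modulus.
Context {R : realType}.
Local Notation C := R[i].
Implicit Types (x y z w : C) (U : set C).
Local Open Scope complex_scope.

Lemma cabsE z : cabs z = Num.sqrt (complex.Re z ^+ 2 + complex.Im z ^+ 2).
Proof. by case: z. Qed.

Lemma cabs_ge0 z : 0 <= cabs z.
Proof. by rewrite cabsE sqrtr_ge0. Qed.

Lemma cabsD x y : cabs (x + y) <= cabs x + cabs y.
Proof. exact: (@le_normcD R x y). Qed.

Lemma cabsN z : cabs (- z) = cabs z.
Proof. exact: (@normcN R z). Qed.

Lemma cabsM x y : cabs (x * y) = cabs x * cabs y.
Proof. exact: ComplexField.Normc.normcM. Qed.

Lemma cabs_distC x y : cabs (x - y) = cabs (y - x).
Proof. by rewrite -cabsN opprB. Qed.

Lemma cabs_real (r : R) : cabs r%:C = `|r|.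
Proof. by rewrite cabsE /= expr0n addr0 sqrtr_sqr. Qed.

Lemma cabs_sub_le x y : cabs x - cabs y <= cabs (x - y).
Proof. by rewrite lerBlDr -{1}(subrK y x) cabsD. Qed.

Lemma normr_Re_le z : `|complex.Re z| <= cabs z.
Proof. by rewrite cabsE -sqrtr_sqr ler_wsqrtr// lerDl sqr_ge0. Qed.

Lemma normr_Im_le z : `|complex.Im z| <= cabs z.
Proof. by rewrite cabsE -sqrtr_sqr ler_wsqrtr// lerDr sqr_ge0. Qed.

Lemma cabs_le_ReIm z : cabs z <= `|complex.Re z| + `|complex.Im z|.
Proof.
case: z => a b; have -> : a +i* b = a%:C + 'i * b%:C by simpc.
apply: le_trans (cabsD _ _) _; rewrite cabsM !cabs_real /=.
by rewrite /ComplexField.Normc.normc expr0n add0r expr1n sqrtr1 mul1r; simpc.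
Qed.

Lemma normcE z : `|z| = (cabs z)%:C. Proof. by case: z. Qed.

Lemma ReD x y : complex.Re (x + y) = complex.Re x + complex.Re y.
Proof. by case: x; case: y. Qed.

Lemma ImD x y : complex.Im (x + y) = complex.Im x + complex.Im y.
Proof. by case: x; case: y. Qed.

Lemma ReB x y : complex.Re (x - y) = complex.Re x - complex.Re y.
Proof. by case: x; case: y. Qed.

Lemma ImB x y : complex.Im (x - y) = complex.Im x - complex.Im y.
Proof. by case: x; case: y. Qed.

(** The balls of the library topology have radii in C; positive elements of C are
    positive reals, which allows all later arguments to use real radii. *)
Lemma nbhs_discP z U :
  nbhs z U <-> exists2 d : R, 0 < d & disc z d `<=` U.
Proof.
split.
  move=> /nbhs_ballP[e /= e0 eU]; exists (complex.Re e).
    by move: e0; case: (e) => a b; rewrite ltcE /= => /andP[].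
  move=> w /= zw; apply: eU; rewrite -ball_normE /= normcE cabs_distC.
  by move: e0 zw; case: (e) => a b; rewrite !ltcE /= => /andP[/eqP-> _] ->; rewrite eqxx.
move=> [d d0 dU]; apply/nbhs_ballP; exists d%:C => /=; first by rewrite ltcR.
move=> w; rewrite -ball_normE /= normcE ltcR => zw.
by apply: dU; rewrite /disc/= cabs_distC.
Qed.

Lemma open_discP U :
  open U <-> forall z, U z -> exists2 d : R, 0 < d & disc z d `<=` U.
Proof.
by rewrite openE; split=> Uo z /Uo /nbhs_discP.
Qed.

Lemma continuous_discP (f : C -> C) z :
  {for z, continuous f} <->
  forall e : R, 0 < e -> exists2 d : R, 0 < d &
    forall w, cabs (w - z) < d -> cabs (f w - f z) < e.
Proof.
split=> [fz e e0|fz U /nbhs_discP[e e0 eU]].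
  have /fz/nbhs_discP[d d0 dU] : nbhs (f z) (disc (f z) e).
    by apply/nbhs_discP; exists e.
  by exists d => // w wz; apply: dU.
have [d d0 df] := fz _ e0; apply/nbhs_discP; exists d => // w wz.
by apply: eU; exact: df.
Qed.

Lemma derivable_continuous (f : C -> C) z : derivable f z 1 -> {for z, continuous f}.
Proof. by move=> /derivable1_diffP/differentiable_continuous. Qed.

Lemma derive1_approx (f : C -> C) z : derivable f z 1 ->
  forall e : R, 0 < e -> exists2 d : R, 0 < d & forall h, cabs h < d ->
    cabs (f (z + h) - f z - derive1 f z * h) <= e * cabs h.
Proof.
move=> fz e e0.
have : (fun h : C => h^-1 *: (f (h *: 1 + z) - f z)) @ 0^' --> derive1 f z.
  by rewrite derive1E; exact: fz.
have /[swap]/[apply] : nbhs (derive1 f z) (disc (derive1 f z) e).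
  by apply/nbhs_discP; exists e.
move=> /nbhs_discP[d d0 dU]; exists d => // h hd.
have [->|h0] := eqVneq h 0.
  by rewrite addr0 subrr mulr0 subr0 ComplexField.Normc.normc0 mulr0.
have := dU h; rewrite /disc /= subr0 => /(_ hd h0) /ltW.
have -> : h *: (1 : C) + z = z + h by rewrite /GRing.scale /= mulr1 addrC.
move=> he.
have -> : f (z + h) - f z - derive1 f z * h =
    (h^-1 *: (f (z + h) - f z) - derive1 f z) * h.
  by rewrite /GRing.scale /= mulrBl mulrAC mulVf// mul1r.
by rewrite cabsM ler_wpM2r// cabs_ge0.
Qed.

End Modulus.

(** * The complex exponential *)

Section ComplexExponential.
Context {R : realType}.
Local Notation C := R[i].
Implicit Types (x y : R) (z w : C).
Local Open Scope complex_scope.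

Lemma cexpD z w : cexp (z + w) = cexp z * cexp w.
Proof.
case: z w => [a b] [c d]; rewrite /cexp /= expRD cosD sinD.
by apply/eqP; rewrite eq_complex /=; apply/andP; split; apply/eqP; ring.
Qed.

Lemma cexp0 : cexp (0 : C) = 1.
Proof.
by rewrite /cexp /= expR0 cos0 sin0 mul1r.
Qed.

Lemma cabs_cexp z : cabs (cexp z) = expR (complex.Re z).
Proof.
rewrite /cexp cabsM cabs_real (ger0_norm (expR_ge0 _)).
by rewrite /ComplexField.Normc.normc cos2Dsin2 sqrtr1 mulr1.
Qed.

Lemma cexp_neq0 z : cexp z != 0.
Proof.
apply/eqP => z0; have := cabs_cexp z.
by rewrite z0 ComplexField.Normc.normc0 => /esym/eqP; rewrite expR_eq0.
Qed.

(** The periods of the exponential. *)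
Definition turn (k : int) : C := 0 +i* (k%:~R * (pi *+ 2)).

Lemma turnD j k : turn (j + k) = turn j + turn k.
Proof. by rewrite /turn intrD mulrDl; simpc. Qed.

Lemma turnN k : turn (- k) = - turn k.
Proof. by rewrite /turn intrN mulNr; simpc. Qed.

Lemma turn0 : turn 0 = 0.
Proof. by rewrite /turn mul0r. Qed.

Lemma turn1 : turn 1 = 0 +i* (2 * pi).
Proof. by rewrite /turn mul1r mulr_natl. Qed.

Lemma cexp_turn k : cexp (turn k) = 1.
Proof.
have turnn (n : nat) : cexp (turn n) = 1.
  elim: n => [|n IHn]; first by rewrite turn0 cexp0.
  rewrite -addn1 PoszD turnD cexpD IHn mul1r turn1 /cexp /= expR0 mul1r.
  by rewrite mulr_natl cos2pi sin2pi.
case: k => n //; have := cexpD (turn (Negz n)) (turn n.+1).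
by rewrite turnn mulr1 -turnD NegzE addNr turn0 cexp0 => ->.
Qed.

Lemma cexpD_turn z k : cexp (z + turn k) = cexp z.
Proof. by rewrite cexpD cexp_turn mulr1. Qed.

Lemma exists_turn_Im z : exists k, `|complex.Im (z - turn k)| <= pi.
Proof.
pose y := complex.Im z; pose k := Num.floor ((y + pi) / (pi *+ 2)).
have pi2 : 0 < (pi : R) *+ 2 by rewrite pmulrn_lgt0// pi_gt0.
have kle : k%:~R * (pi *+ 2) <= y + pi.
  by rewrite -ler_pdivlMr// floor_le_tmp.
have klt : y + pi < (k%:~R + 1) * (pi *+ 2).
  by rewrite -ltr_pdivrMr// -intrD1 floorD1_gt.
exists k; rewrite ImB /= -/y ler_norml.
by move: kle klt; rewrite mulrDl mul1r mulr2n; lra.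
Qed.

Lemma cexp_eq1 z : cexp z = 1 -> exists k, z = turn k.
Proof.
move=> z1; have [k zk] := exists_turn_Im z; exists k.
apply/eqP; rewrite -subr_eq0.
have : cexp (z - turn k) = 1 by rewrite -turnN cexpD_turn.
move: (z - turn k) zk => {z z1} z zpi z1.
have := cabs_cexp z; rewrite z1 ComplexField.Normc.normc1 => /esym Re0.
have {}Re0 : complex.Re z = 0 by apply: expR_inj; rewrite Re0 expR0.
have c1 : cos (complex.Im z) = 1.
  by move: z1; rewrite /cexp Re0 expR0 mul1r => -[].
have : `|complex.Im z| = 0.
  apply: (@cos_inj R); rewrite ?in_itv /= ?normr_ge0 ?lexx ?pi_ge0//.
  by rewrite cos_norm c1 cos0.
move=> /eqP; rewrite normr_eq0 => /eqP Im0.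
by apply/eqP; case: z Re0 Im0 {zpi z1 c1} => a b /= -> ->.
Qed.

Lemma cexp_eq z w : cexp z = cexp w -> exists k, z = w + turn k.
Proof.
move=> zw; have [k zwk] : exists k, z - w = turn k.
  apply: cexp_eq1; apply: (mulIf (cexp_neq0 w)).
  by rewrite -cexpD subrK zw mul1r.
by exists k; rewrite -zwk addrC subrK.
Qed.

Lemma Re_eq_ln_cabs z w : cexp w = z -> complex.Re w = ln (cabs z).
Proof. by move=> <-; rewrite cabs_cexp expRK. Qed.

Lemma cabs_gt0 z : z != 0 -> 0 < cabs z.
Proof.
move=> z0; rewrite lt_neqAle cabs_ge0 andbT eq_sym; apply: contra z0 => /eqP.
by move/ComplexField.Normc.eq0_normc => ->.
Qed.

(** The sign of Im z decides which of the angles +-acos (Re z / |z|) has the right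
    sine. *)
Lemma exists_log z : z != 0 -> exists2 w, cexp w = z & `|complex.Im w| <= pi.
Proof.
move=> /cabs_gt0; case: z => a b; set r := cabs _ => r0.
have r2 : r ^+ 2 = a ^+ 2 + b ^+ 2 by rewrite sqr_sqrtr// addr_ge0 ?sqr_ge0.
have ar : -1 <= a / r <= 1.
  rewrite -ler_norml normrM normfV (gtr0_norm r0) ler_pdivrMr// mul1r.
  exact: (normr_Re_le (a +i* b)).
pose s : R := if 0 <= b then 1 else -1.
have s_cases : (s = 1 /\ `|b| = b) \/ (s = -1 /\ `|b| = - b).
  rewrite /s; case: ltP => b0; last by left; rewrite ger0_norm.
  by right; rewrite ltr0_norm.
have cs : cos (s * acos (a / r)) = a / r.
  have [[-> _]|[-> _]] := s_cases.
    by rewrite mul1r acosK// in_itv.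
  by rewrite mulN1r cosN acosK// in_itv.
have ss : sin (s * acos (a / r)) = b / r.
  have h : sin (acos (a / r)) = `|b| / r.
    have -> : `|b| / r = `|b / r| by rewrite normf_div (gtr0_norm r0).
    rewrite sin_acos// -sqrtr_sqr.
    congr Num.sqrt; apply: (mulIf (lt0r_neq0 (exprn_gt0 2 r0))).
    rewrite mulrBl !expr_div_n !divfK ?mul1r ?lt0r_neq0 ?exprn_gt0// r2.
    by rewrite addrAC subrr add0r.
  have [[-> nb]|[-> nb]] := s_cases.
    by rewrite mul1r h nb.
  by rewrite mulN1r sinN h nb mulNr opprK.
exists (ln r +i* (s * acos (a / r))).
  rewrite /cexp /= cs ss lnK ?posrE//; simpc.
  by rewrite ![r * _]mulrC !divfK// lt0r_neq0.
rewrite /= normrM (_ : `|s| = 1) ?mul1r; last first.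
  by have [[-> _]|[-> _]] := s_cases; rewrite ?normrN normr1.
by rewrite ger0_norm ?acos_ge0// acos_lepi.
Qed.

Lemma normr_sin_le x : `|sin x| <= `|x|.
Proof.
wlog x0 : x / 0 <= x.
  move=> h; have [/h//|x0] := leP 0 x.
  by rewrite -[x]opprK sinN !(normrN (- x), normrN (sin _)); apply: h; rewrite oppr_ge0 ltW.
have [c _] := MVT_segment x0 (fun y _ => is_derive_sin y)
  (continuous_subspaceT (@continuous_sin R)).
rewrite sin0 !subr0 => ->; rewrite normrM ler_piMl//.
by rewrite ler_norml cos_geN1 cos_le1.
Qed.

Lemma normr_cosB1_le x : `|cos x - 1| <= `|x|.
Proof.
have -> : cos x - 1 = - (sin (x / 2) ^+ 2 *+ 2).
  rewrite {1}(_ : x = (x / 2) *+ 2); last by rewrite -mulr_natr divfK// pnatr_eq0.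
  by rewrite cos_mulr2n cos2sin2; ring.
have h1 := normr_sin_le (x / 2).
have h2 : `|sin (x / 2)| <= 1 by exact: sin_max.
have -> : `|x| = `|x / 2| *+ 2.
  by rewrite normrM [`|2^-1|]ger0_norm ?invr_ge0// -[RHS]mulr_natr divfK// pnatr_eq0.
rewrite normrN normrMn normrX lerMn2r /= expr2 (le_trans _ h1)//.
by rewrite ler_piMl.
Qed.

Lemma normr_expRB1_le x : `|x| <= 2 -> `|expR x - 1| <= expR 2 * `|x|.
Proof.
move=> x2; have [x0|x0] := leP 0 x.
  have e1 : 1 <= expR x by rewrite -expR0 ler_expR.
  rewrite (ger0_norm x0) ger0_norm ?subr_ge0//.
  have h : 1 - x <= expR (- x) by exact: expR_ge1Dx.
  have : expR x * (1 - x) <= expR x * expR (- x) by rewrite ler_wpM2l// expR_ge0.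
  rewrite -expRD subrr expR0 => h1.
  have h2 : expR x * x <= expR 2 * x.
    by rewrite ler_wpM2r// ler_expR (le_trans _ x2)// ler_norm.
  by move: h1 h2; lra.
have e1 : expR x <= 1 by rewrite expR_le1 ltW.
rewrite (ltr0_norm x0) ler0_norm ?subr_le0//.
have h := expR_ge1Dx x.
have h2 : - x <= expR 2 * (- x) by rewrite ler_peMl ?oppr_ge0 ?(ltW x0)// -expR0 ler_expR.
by move: h h2; lra.
Qed.

Lemma cabs_cexpB1_le z : cabs z <= 2 -> cabs (cexp z - 1) <= 3 * expR 2 * cabs z.
Proof.
move=> z2; apply: le_trans (cabs_le_ReIm _) _.
have xz := normr_Re_le z; have yz := normr_Im_le z.
set x := complex.Re z in xz; set y := complex.Im z in yz.
have z0 := cabs_ge0 z.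
have hx := normr_expRB1_le (le_trans xz z2).
have ex : expR x <= expR 2.
  by rewrite ler_expR (le_trans (ler_norm x))// (le_trans xz).
have bound (b c : R) : `|b| <= cabs z -> `|c| <= `|b| -> `|expR x * c| <= expR 2 * cabs z.
  move=> bz cb; rewrite normrM ger0_norm ?expR_ge0// ler_pM ?expR_ge0//.
  exact: le_trans bz.
rewrite (_ : complex.Re _ = expR x * (cos y - 1) + (expR x - 1)); last first.
  by rewrite ReB /= -/x -/y; ring.
rewrite (_ : complex.Im _ = expR x * sin y); last by rewrite ImB /= -/x -/y; ring.
have h1 := bound _ _ yz (normr_cosB1_le y).
have h2 := bound _ _ yz (normr_sin_le y).
have h3 := ler_normD (expR x * (cos y - 1)) (expR x - 1).
have h4 : expR 2 * `|x| <= expR 2 * cabs z by rewrite ler_wpM2l// expR_ge0.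
by move: h1 h2 h3 h4 hx; lra.
Qed.

Lemma cabs_cexpB_le z w : cabs (z - w) <= 2 ->
  cabs (cexp z - cexp w) <= 3 * expR 2 * cabs (cexp w) * cabs (z - w).
Proof.
move=> zw; have -> : cexp z - cexp w = cexp w * (cexp (z - w) - 1).
  by rewrite mulrBr -cexpD mulr1 [w + _]addrC subrK.
rewrite cabsM [_ * cabs (cexp w)]mulrC -mulrA ler_wpM2l ?cabs_ge0//.
exact: cabs_cexpB1_le.
Qed.

Lemma continuous_cexp z : {for z, continuous (@cexp R)}.
Proof.
apply/continuous_discP => e e0.
pose K := 3 * expR 2 * cabs (cexp z).
have K0 : 0 < K by rewrite !mulr_gt0 ?expR_gt0// cabs_cexp expR_gt0.
exists (Num.min 2 (e / K)); first by rewrite lt_min ltr0n divr_gt0.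
move=> w; rewrite lt_min => /andP[w2 we].
apply: le_lt_trans (cabs_cexpB_le (ltW w2)) _.
by rewrite mulrC -ltr_pdivlMr.
Qed.

(** A quantitative form of the openness of exp at 0, through the logarithm
    ln|z| + i atan (Im z / Re z) of the right half-plane. *)
Lemma cexp_surj_near1 (e : R) : 0 < e ->
  exists2 d : R, 0 < d & forall z, cabs (z - 1) < d ->
    exists2 w, cabs w < e & cexp w = z.
Proof.
move=> e0; have e20 : 0 < e / 2 by rewrite divr_gt0.
have [d1 /= d10 d1P] : exists2 d : R, 0 < d & forall q, `|q| < d -> `|atan q| < e / 2.
  have /(_ _ _ e20) := @cvgr_dist_lt R R R (nbhs (0 : R)) _ atan (atan 0) (@continuous_atan R 0).
  move=> /nbhs_ballP[d /= d0 dP]; exists d => // q qd.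
  have := dP q; rewrite -ball_normE /= sub0r normrN => /(_ qd).
  by rewrite atan0 sub0r normrN.
have [d2 /= d20 d2P] : exists2 d : R, 0 < d & forall r, `|r - 1| < d -> `|ln r| < e / 2.
  have /(_ _ _ e20) := @cvgr_dist_lt R R R (nbhs (1 : R)) _ (@ln R) (ln 1) (continuous_ln ltr01).
  move=> /nbhs_ballP[d /= d0 dP]; exists d => // q qd.
  have := dP q; rewrite -ball_normE /= distrC => /(_ qd).
  by rewrite ln1 sub0r normrN.
exists (Num.min (1 / 2) (Num.min (d1 / 2) d2)).
  by rewrite !lt_min d20 !divr_gt0.
move=> z; rewrite !lt_min => /and3P[zh zd1 zd2].
pose a := complex.Re z; pose b := complex.Im z; pose r := cabs z.
have a_ge : 1 / 2 <= a.
  have := normr_Re_le (z - 1); rewrite ReB /= -/a distrC => h.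
  have := le_lt_trans (le_trans (ler_norm _) h) zh; lra.
have b_le : `|b| <= cabs (z - 1).
  by have := normr_Im_le (z - 1); rewrite ImB /= subr0.
have a0 : 0 < a by lra.
have r0 : 0 < r by rewrite cabs_gt0//; apply/eqP => z0; move: a0; rewrite /a z0 ltxx.
pose q := b / a.
have qd1 : `|q| < d1.
  rewrite normrM normfV (gtr0_norm a0) ltr_pdivrMr//.
  apply: le_lt_trans b_le _; apply: lt_le_trans zd1 _.
  by rewrite ler_pM2l// -[leLHS]mul1r.
have rd2 : `|r - 1| < d2.
  apply: le_lt_trans zd2; rewrite ler_norml.
  have := cabs_sub_le z 1; have := cabs_sub_le 1 z.
  rewrite (cabs_distC 1) ComplexField.Normc.normc1 -/r; lra.
have rE : Num.sqrt (1 + q ^+ 2) = r / a.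
  rewrite -[r / a]ger0_norm ?divr_ge0 ?ltW// -sqrtr_sqr; congr Num.sqrt.
  rewrite !expr_div_n /r cabsE sqr_sqrtr ?addr_ge0 ?sqr_ge0// mulrDl divff//.
  by rewrite lt0r_neq0 ?exprn_gt0.
have cq : cos (atan q) = a / r by rewrite cos_atan rE invf_div.
have sq : sin (atan q) = b / r.
  have c0 : cos (atan q) != 0 by rewrite cq mulf_neq0 ?invr_eq0 ?lt0r_neq0.
  have : tan (atan q) = q by exact: atanK.
  rewrite /tan => /(canRL (divfK c0)) ->; rewrite cq /q.
  by rewrite mulrA divfK ?lt0r_neq0.
exists (ln r +i* atan q).
  apply: le_lt_trans (cabs_le_ReIm _) _ => /=.
  by have := d1P _ qd1; have := d2P _ rd2; lra.
rewrite /cexp /= cq sq lnK ?posrE//; simpc.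
rewrite ![r * _]mulrC !divfK ?lt0r_neq0//.
by rewrite /a /b; case: (z).
Qed.

End ComplexExponential.

(** * Tracts and logarithmic components *)

Section LogarithmicComponents.
Context {R : realType}.
Local Notation C := R[i].
Implicit Types (D U V T : set C) (u w : C).
Local Open Scope complex_scope.

Lemma disc_sub_component U w (d : R) : disc w d `<=` U ->
  disc w d `<=` connected_component U w.
Proof.
move=> dU w' ww'; pose gamma (s : R) := w + s%:C * (w' - w).
have g_lip s s' : cabs (gamma s' - gamma s) = `|s' - s| * cabs (w' - w).
  rewrite -cabs_real -cabsM; congr cabs; rewrite /gamma.
  by rewrite rmorphB /=; ring.
have g_cont : continuous gamma.
  move=> s U' /nbhs_discP[e e0 eU']; apply/nbhs_ballP.
  have K0 : 0 < 1 + cabs (w' - w) by rewrite ltr_wpDr// cabs_ge0.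
  exists (e / (1 + cabs (w' - w))); first by rewrite /= divr_gt0.
  move=> s'; rewrite -ball_normE /= distrC ltr_pdivlMr// => ss'.
  apply: eU'; rewrite /disc /= g_lip; apply: le_lt_trans ss'.
  by rewrite ler_wpM2l// lerDr.
have gw : gamma 0 = w by rewrite /gamma mul0r addr0.
have gw' : gamma 1 = w' by rewrite /gamma mul1r addrC subrK.
apply: (@connected_component_max _ _ (gamma @` `[0, 1])).
- by exists 0; rewrite //= in_itv /= ler01 lexx.
- move=> _ [s /= /[!in_itv]/= /andP[s0 s1] <-]; apply: dU.
  rewrite /disc /= -gw g_lip subr0 ger0_norm//.
  by apply: le_lt_trans ww'; rewrite ler_piMl// cabs_ge0.
- apply: connected_continuous_connected (@segment_connected _ _ _) _.
  exact: continuous_subspaceT.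
- by exists 1; rewrite //= in_itv /= ler01 lexx.
Qed.

Lemma component_turn V w w' k :
    connected_component (cexp @^-1` V) w w' ->
  connected_component (cexp @^-1` V) (w + turn k) (w' + turn k).
Proof.
move=> [B [Bw BV Bc] Bw'].
apply: (@connected_component_max _ _ ((fun z => z + turn k) @` B)).
- by exists w.
- by move=> _ [z /BV Vz <-]; rewrite /preimage /= cexpD_turn.
- apply: connected_continuous_connected Bc _; apply: continuous_subspaceT.
  by move=> z; apply: continuousD; [exact: cvg_id|exact: cst_continuous].
- by exists w'.
Qed.

(** If w and w' lie in one component of exp^-1(V), then a component reaches exp w
    if and only if it reaches exp w': it contains w + 2 pi i k for some k, and
    translation by a period permutes the components. *)
Lemma component_cexp_transfer V w0 w w' w1 :
    connected_component (cexp @^-1` V) w w' ->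
    connected_component (cexp @^-1` V) w0 w1 -> cexp w1 = cexp w ->
  exists2 w1', connected_component (cexp @^-1` V) w0 w1' & cexp w1' = cexp w'.
Proof.
move=> ww' w01 /cexp_eq[k w1E]; exists (w' + turn k); last exact: cexpD_turn.
apply: connected_component_trans w01 _; rewrite w1E.
exact: component_turn.
Qed.

(** One component of exp^-1(V) over a tract T covers all of T. Being in the image
    of the component is a locally constant property on V, because small discs of
    exp^-1(V) stay in one component and exp is open; T is connected. *)
Lemma tract_sub_cexp_component V T w0 : open V -> ~ V 0 ->
    connected T -> T `<=` V -> T (cexp w0) ->
  T `<=` cexp @` connected_component (cexp @^-1` V) w0.
Proof.
move=> Vo V0 Tc TV Tw0; set W := connected_component _ w0.
have Do : open (cexp @^-1` V).
  by apply: open_comp Vo => z _; exact: continuous_cexp.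
have loc u : V u -> exists2 d : R, 0 < d & forall u', disc u d u' ->
    (cexp @` W) u <-> (cexp @` W) u'.
  move=> Vu; have u0 : u != 0 by apply: contra_not_neq V0 => <-.
  have [w wu _] := exists_log u0.
  have /open_discP/(_ w)[|e e0 eD] := Do; first by rewrite /preimage /= wu.
  have [d d0 dP] := cexp_surj_near1 e0.
  exists (d * cabs u); first by rewrite mulr_gt0// cabs_gt0.
  move=> u'; rewrite /disc /= => uu'.
  have [|h he hE] := dP (u' / u).
    by rewrite -[1](divff u0) -mulrBl cabsM ComplexField.Normc.normcV ltr_pdivrMr ?cabs_gt0.
  have wh : connected_component (cexp @^-1` V) w (w + h).
    by apply: disc_sub_component eD _ _; rewrite /disc /= addrAC subrr add0r.
  have u'E : cexp (w + h) = u' by rewrite cexpD hE wu mulrC divfK.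
  split=> -[w1 Ww1 w1E].
    by have := component_cexp_transfer wh Ww1; rewrite wu u'E => /(_ w1E)[w2]; exists w2.
  have := component_cexp_transfer (connected_component_sym wh) Ww1.
  by rewrite wu u'E => /(_ w1E)[w2]; exists w2.
have TE : T `&` (cexp @` W) = T.
  apply: Tc.
  - exists (cexp w0); split=> //; exists w0 => //.
    by apply: connected_component_refl; exact: TV.
  - exists (V `&` (cexp @` W)); last by rewrite setIA (setIidl TV).
    apply/open_discP => u [Vu Wu]; have [d d0 dP] := loc _ Vu.
    have /open_discP/(_ _ Vu)[d' d'0 dV] := Vo.
    exists (Num.min d d'); first by rewrite lt_min d0.
    by move=> u'; rewrite /disc /= lt_min => /andP[/dP/iffLR/(_ Wu) Wu' /dV].
  - exists (~` (V `&` ~` (cexp @` W))).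
      apply: open_closedC; apply/open_discP => u [Vu Wu].
      have [d d0 dP] := loc _ Vu.
      have /open_discP/(_ _ Vu)[d' d'0 dV] := Vo.
      exists (Num.min d d'); first by rewrite lt_min d0.
      move=> u'; rewrite /disc /= lt_min => /andP[/dP/iffRL Wu' /dV Vu'].
      by split=> // /Wu'.
    apply/seteqP; split=> u [Tu].
      by move=> Wu; split=> // -[].
    by move=> nVW; split=> //; apply: contrapT => Wu; apply: nVW; split=> //; exact: TV.
by move=> u; rewrite -TE => -[].
Qed.

(** So, up to the periods 2 pi i k, there are no more logarithmic components than
    tracts. This is where the number N of tracts enters the estimate. *)
Lemma enum_log_components V (N : nat) : open V -> ~ V 0 ->
    (components V #= `I_N)%card ->
  exists W : nat -> set C,
    (forall i, (i < N)%N -> components (cexp @^-1` V) (W i)) /\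
    V `<=` \bigcup_(i < N) cexp @` W i.
Proof.
move=> Vo V0; rewrite card_eq_sym => /card_set_bijP[T [T_comp _ T_surj]].
have /choice[w wP] i : exists w, (i < N)%N ->
    V (cexp w) /\ T i = connected_component V (cexp w).
  have [iN|_] := boolP (i < N)%N; last by exists 0.
  have [u Vu <-] := T_comp _ iN.
  have [|w wu _] := @exists_log _ u; first by apply: contra_not_neq V0 => <-.
  by exists w; rewrite wu.
exists (fun i => connected_component (cexp @^-1` V) (w i)); split=> [i iN|u Vu].
  by exists (w i) => //; have [] := wP _ iN.
have [|i iN TiE] := T_surj (connected_component V u); first by exists u.
exists i => //; have [Vw Ti] := wP _ iN.
apply: (tract_sub_cexp_component (T := T i)) => //; rewrite ?Ti.
- exact: component_connected.
- exact: connected_component_sub.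
- exact: connected_component_refl.
- by rewrite -Ti TiE; exact: connected_component_refl.
Qed.

End LogarithmicComponents.

(** * Contraction of inverse branches *)

Section InverseBranches.
Context {R : realType}.
Local Notation C := R[i].
Local Open Scope complex_scope.

(** Continuous induction along [0, 1]. The local Lipschitz bound is available only
    at points that the global bound has already placed near h 0; here this
    expresses that the expansion of F is known only on a half-plane, and that the
    inverse branch has to be kept inside it. *)
Lemma continuation_lipschitz (h : R -> C) (L : R) : 0 <= L ->
    (forall s, 0 <= s <= 1 -> forall e : R, 0 < e -> exists2 d : R, 0 < d &
      forall s', 0 <= s' <= 1 -> `|s' - s| < d -> cabs (h s' - h s) < e) ->
    (forall s, 0 <= s <= 1 -> cabs (h s - h 0) <= L * s ->
      exists2 d : R, 0 < d & forall s', s <= s' <= 1 -> s' - s < d ->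
        cabs (h s' - h s) <= L * (s' - s)) ->
  cabs (h 1 - h 0) <= L.
Proof.
move=> L0 h_cont h_loc.
pose S : set R := [set s | 0 <= s <= 1 /\
  forall s', 0 <= s' <= s -> cabs (h s' - h 0) <= L * s'].
have S0 : S 0.
  split=> [|s' /le_anti <-]; first by rewrite lexx ler01.
  by rewrite subrr mulr0 ComplexField.Normc.normc0.
have S_ub : has_ubound S by exists 1 => s [/andP[]].
set m := sup S; have m0 : 0 <= m by apply: ub_le_sup.
have m1 : m <= 1 by apply: ge_sup => [|s [/andP[]]//]; exists 0.
have m01 : 0 <= m <= 1 by rewrite m0.
have below s : 0 <= s -> s < m -> cabs (h s - h 0) <= L * s.
  move=> s0 /sup_gt[|s' [_ Ss'] ss']; first by exists 0.
  by apply: Ss'; rewrite s0 ltW.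
(* The bound passes to the supremum by continuity. *)
have at_m : cabs (h m - h 0) <= L * m.
  have [m_eq0|m_neq0] := eqVneq m 0.
    by rewrite m_eq0 subrr mulr0 ComplexField.Normc.normc0.
  have {m_neq0}m_gt0 : 0 < m by rewrite lt_neqAle eq_sym m_neq0.
  apply/ler_addgt0Pr => e e0; have [d d0 hd] := h_cont _ m01 _ e0.
  pose s := Num.max 0 (m - d / 2).
  have s0 : 0 <= s by rewrite le_max lexx.
  have sm : s < m by rewrite gt_max m_gt0; lra.
  have sd : m - d / 2 <= s by rewrite le_max lexx orbT.
  have ms : `|s - m| < d by rewrite ltr0_norm ?subr_lt0//; lra.
  have s1 : s <= 1 by rewrite (le_trans (ltW sm)).
  have := hd s; rewrite s0 s1 => /(_ isT ms); rewrite cabs_distC => hms.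
  have := cabsD (h m - h s) (h s - h 0); rewrite addrA subrK.
  have : L * s <= L * m by rewrite ler_wpM2l// ltW.
  by have := below _ s0 sm; lra.
(* The local bound at m then carries it past m, unless m = 1. *)
have [m_lt1|m_ge1] := ltP m 1; last first.
  suff m_eq1 : m = 1 by move: at_m; rewrite m_eq1 mulr1.
  by apply: le_anti; rewrite m1.
have [d d0 hd] := h_loc _ m01 at_m.
pose s := Num.min 1 (m + d / 2).
have s1 : s <= 1 by rewrite ge_min lexx.
have ms : m < s by rewrite lt_min m_lt1; lra.
have sd : s <= m + d / 2 by rewrite ge_min lexx orbT.
suff : s <= m by rewrite leNgt ms.
apply: ub_le_sup => //; split=> [|s' /andP[s'0 s's]]; first by rewrite s1 ltW// (le_lt_trans m0).
have [/below->//|ms'] := ltP s' m.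
have := hd s'; rewrite ms' (le_trans s's)// => /(_ isT) hs'.
have := cabsD (h s' - h m) (h m - h 0); rewrite addrA subrK.
have {hs'} : cabs (h s' - h m) <= L * (s' - m) by apply: hs'; lra.
by move: at_m; rewrite mulrBr; lra.
Qed.

(** An inverse branch G of F contracts by L along a segment on which the expansion
    factor b |z| exceeds 1 / L, as long as G starts far enough inside the
    half-plane that it cannot leave it within the length L |c - p|. The contraction
    comes from F and the continuity of G: where F expands infinitesimally by more than
    1 / L, its continuous inverse contracts by L. *)
Lemma inverse_branch_lipschitz (r0 b L : R) (F G : C -> C) (p c : C) :
    0 < b -> 0 < L -> holomorphic_on (half_plane r0) G ->
    (forall z, half_plane r0 z -> F (G z) = z) ->
    (forall z, half_plane r0 z -> derivable F (G z) 1) ->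
    (forall z, half_plane r0 z -> half_plane r0 (G z) ->
      b * cabs z <= cabs (derive1 F (G z))) ->
    half_plane r0 p -> half_plane r0 c ->
    (forall s, 0 <= s <= 1 -> 1 < L * (b * cabs (p + s%:C * (c - p)))) ->
    r0 + L * cabs (c - p) < complex.Re (G p) ->
  cabs (G c - G p) <= L * cabs (c - p).
Proof.
move=> b0 L0 G_hol FG F_der F_exp pr0 cr0 seg Gp.
set D := cabs (c - p); have D0 : 0 <= D by exact: cabs_ge0.
pose gamma (s : R) := p + s%:C * (c - p).
have g_lip s s' : cabs (gamma s' - gamma s) = `|s' - s| * D.
  by rewrite -cabs_real -cabsM; congr cabs; rewrite /gamma rmorphB /=; ring.
have g0 : gamma 0 = p by rewrite /gamma mul0r addr0.
have g1 : gamma 1 = c by rewrite /gamma mul1r addrC subrK.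
have g_in s : 0 <= s <= 1 -> half_plane r0 (gamma s).
  move=> /andP[s0 s1]; rewrite /half_plane /= /gamma ReD.
  have -> : complex.Re (s%:C * (c - p)) = s * (complex.Re c - complex.Re p).
    by rewrite -ReB; case: (c - p) => x y; simpc.
  move: pr0 cr0; rewrite /half_plane /= => pr0 cr0.
  have [->|sn0] := eqVneq s 0; first by rewrite mul0r addr0.
  have s_gt0 : 0 < s by rewrite lt_neqAle eq_sym sn0.
  have h1 : 0 < s * (complex.Re c - r0) by rewrite mulr_gt0// subr_gt0.
  have h2 : 0 <= (1 - s) * (complex.Re p - r0).
    by rewrite mulr_ge0// subr_ge0// ltW.
  by move: h1 h2; rewrite mulrBl mul1r; lra.
have DLd (s s' e : R) : 0 < e -> `|s' - s| < e / (D + 1) -> cabs (gamma s' - gamma s) < e.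
  have D1 : 0 < D + 1 by rewrite ltr_wpDl.
  move=> e0; rewrite ltr_pdivlMr// g_lip; apply: le_lt_trans.
  by rewrite ler_wpM2l// lerDl.
have G_cont s : 0 <= s <= 1 -> forall e : R, 0 < e -> exists2 d : R, 0 < d &
    forall s', `|s' - s| < d -> cabs (G (gamma s') - G (gamma s)) < e.
  move=> s01 e e0.
  have /derivable_continuous/continuous_discP/(_ _ e0)[d d0 Gd] := G_hol _ (g_in _ s01).
  exists (d / (D + 1)); first by rewrite divr_gt0// ltr_wpDl.
  by move=> s' /(DLd _ _ _ d0) /Gd.
rewrite -g1 -{1}g0.
apply: (@continuation_lipschitz (G \o gamma)); first by rewrite mulr_ge0// ltW.
  by move=> s s01 e e0; have [d d0 hd] := G_cont _ s01 _ e0; exists d => // s' _ /hd.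
move=> s s01 /= hs; set w := G (gamma s).
have w_in : half_plane r0 w.
  have := normr_Re_le (w - G p); rewrite ReB => h1.
  have h2 : L * D * s <= L * D.
    by case/andP: s01 => s0 s1; rewrite ler_piMr// mulr_ge0// ltW.
  have h3 := ler_norm (- (complex.Re w - complex.Re (G p))).
  move: hs h1 h2 h3 Gp; rewrite normrN /half_plane /= -/D -/w g0; lra.
pose m := cabs (derive1 F w).
have Vm : L^-1 < m.
  have := F_exp _ (g_in _ s01) w_in; apply: lt_le_trans.
  by rewrite -[ltLHS]mul1r ltr_pdivrMr// mulrC; exact: seg.
have e0 : 0 < m - L^-1 by rewrite subr_gt0.
have [d1 d10 Fd] := derive1_approx (F_der _ (g_in _ s01)) e0.
have [d d0 Gd] := G_cont _ s01 _ d10.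
exists d => // s' /andP[ss' s'1] s'd.
have s'01 : 0 <= s' <= 1 by rewrite s'1 (le_trans _ ss')//; case/andP: s01.
have hsd : `|s' - s| < d by rewrite ger0_norm// subr_ge0.
set v := G (gamma s') - w.
have := Fd v (Gd _ hsd); rewrite -/w (_ : w + v = G (gamma s')); last first.
  by rewrite /v addrC subrK.
rewrite !FG; [|exact: g_in|exact: g_in]; move=> Fv.
have gg : cabs (gamma s' - gamma s) = (s' - s) * D.
  by rewrite g_lip ger0_norm// subr_ge0.
have := cabs_sub_le (derive1 F w * v) (gamma s' - gamma s).
rewrite [leRHS]cabs_distC cabsM gg -/m => h1.
have h2 : L^-1 * cabs v <= (s' - s) * D.
  by move: h1 Fv; rewrite mulrBl; lra.
by rewrite -mulrA [D * _]mulrC -ler_pdivrMl.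
Qed.

End InverseBranches.

(** * Power sums *)

Section PowerSums.
Context {R : realType}.
Implicit Types (a s t x : R).

(** A discrete form of the integral of u^-t from a to a + 1, which follows
    from e^u >= 1 + u and ln u <= u - 1. *)
Lemma powRN_telescope a t : 0 < a -> 1 < t ->
  (t - 1) * (a + 1) `^ (- t) <= a `^ (1 - t) - (a + 1) `^ (1 - t).
Proof.
move=> a0 t1; have b0 : 0 < a + 1 by rewrite addr_gt0.
have -> : a `^ (1 - t) = (a + 1) `^ (1 - t) * ((a + 1) / a) `^ (t - 1).
  rewrite -[in LHS](_ : (a + 1) / ((a + 1) / a) = a); last first.
    by rewrite invf_div mulrCA divff ?mulr1// lt0r_neq0.
  rewrite powRM ?invr_ge0 ?divr_ge0 ?ltW//; congr (_ * _).
  by rewrite -powR_inv1 ?divr_ge0 ?ltW// -powRrM mulN1r opprB.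
have h : 1 + (t - 1) / (a + 1) <= ((a + 1) / a) `^ (t - 1).
  have q0 : 0 < a / (a + 1) by rewrite divr_gt0.
  rewrite /powR ifF; last by rewrite gt_eqF// divr_gt0.
  apply: le_trans (expR_ge1Dx _); rewrite lerD2l ler_pM2l ?subr_gt0//.
  rewrite -[(a + 1) / a]invf_div lnV ?posrE//.
  have hl : ln (1 + (a / (a + 1) - 1)) <= a / (a + 1) - 1.
    by apply: le_ln1Dx; rewrite ltrBrDr addNr.
  move: hl; rewrite [1 + _]addrC subrK => hl.
  have e : (a + 1)^-1 = 1 - a / (a + 1) by field; rewrite lt0r_neq0.
  by move: hl; rewrite [X in X <= - _]e; lra.
rewrite -[X in _ <= _ - X]mulr1 -mulrBr.
have -> : (a + 1) `^ (- t) = (a + 1) `^ (1 - t) * (a + 1)^-1.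
  by rewrite -powR_inv1 ?ltW// -powRD ?(lt0r_neq0 b0) ?implybT//; congr (_ `^ _); ring.
rewrite mulrCA ler_wpM2l ?powR_ge0//; move: h; lra.
Qed.

Lemma nneseries_powRN_le x t : 0 < x -> 1 < t ->
  (\sum_(0 <= n <oo) ((x + n%:R) `^ (- t))%:E
    <= (x `^ (- t) + x `^ (1 - t) / (t - 1))%:E)%E.
Proof.
move=> x0 t1; have s0 : 0 < t - 1 by rewrite subr_gt0.
have part m : \sum_(0 <= n < m.+1) (x + n%:R) `^ (- t) <=
    x `^ (- t) + (x `^ (1 - t) - (x + m%:R) `^ (1 - t)) / (t - 1).
  elim: m => [|m IHm]; first by rewrite big_nat1 !addr0 subrr mul0r addr0.
  rewrite big_nat_recr //=; apply: le_trans (lerD IHm (lexx _)) _.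
  have xm : 0 < x + m%:R by rewrite ltr_wpDr.
  have := powRN_telescope xm t1; rewrite -addrA natr1.
  rewrite -ler_pdivlMl// mulrC => h; rewrite -addrA lerD2l.
  by move: h; rewrite !mulrBl; lra.
apply: lime_le; first by apply: is_cvg_nneseries => n _ _; rewrite lee_fin powR_ge0.
near=> m; rewrite sumEFin lee_fin.
have m0 : (0 < m)%N by near: m; exists 1%N.
rewrite -(prednK m0); apply: le_trans (part _) _.
rewrite lerD2l ler_wpM2r ?invr_ge0 ?(ltW s0)//.
by rewrite gerBl powR_ge0.
Unshelve. all: by end_near. Qed.

(** The numerical heart: y is the logarithm of M and x the real part of a
    centre of a ball. The hypothesis on A makes A x^(1 - t) at most 1/9; the
    factor (9/10)^(t - 1), which accounts for x being smaller than y by up to 1,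
    is at least 9/10 because t - 1 <= 1. *)
Lemma branch_sum_le (A x y t : R) : 0 <= A -> 1 < t -> t <= 2 -> 10 <= y -> y - 1 <= x ->
  10 * A <= y `^ (t - 1) ->
  2 * A * (t - 1) * (x `^ (- t) + x `^ (1 - t) / (t - 1)) <= 2^-1.
Proof.
move=> A0 t1 t2 y10 yx hA.
have s0 : 0 < t - 1 by rewrite subr_gt0.
have x9 : 9 <= x by lra.
have x0 : 0 < x by lra.
have hx : 9 * A <= x `^ (t - 1).
  apply: (le_trans (y := ((9 / 10) * y) `^ (t - 1))); last first.
    by apply: ge0_ler_powR; rewrite ?nnegrE; lra.
  rewrite (@powRM _ (9 / 10) y); [|lra|lra].
  have h9 : 9 / 10 <= (9 / 10 : R) `^ (t - 1).
    rewrite -{1}[9 / 10]powRr1; last lra.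
    by apply: ger_powR; lra.
  apply: (le_trans (y := 9 / 10 * (10 * A))); first by lra.
  by rewrite ler_pM// mulr_ge0.
pose P := x `^ (1 - t); have P0 : 0 <= P by exact: powR_ge0.
have PA : A * P <= 9^-1.
  have xs : 0 < x `^ (t - 1) by exact: powR_gt0.
  rewrite /P -(opprB t 1) powRN -ler_pdivlMr ?invr_gt0// invrK.
  by rewrite mulrC ler_pdivlMr// mulrC.
have -> : x `^ (- t) = P / x.
  by rewrite /P -powR_inv1 ?ltW// -powRD ?(lt0r_neq0 x0) ?implybT//; congr (_ `^ _); ring.
have -> : 2 * A * (t - 1) * (P / x + P / (t - 1)) = 2 * (A * P) * ((t - 1) / x + 1).
  by field; rewrite !lt0r_neq0.
have hx9 : (t - 1) / x <= 9^-1.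
  by rewrite ler_pdivrMr//; lra.
have AP0 : 0 <= A * P by rewrite mulr_ge0.
have : 2 * (A * P) * ((t - 1) / x + 1) <= 2 * 9^-1 * (9^-1 + 1).
  by apply: ler_pM; rewrite ?mulr_ge0 ?addr_ge0 ?divr_ge0 ?lerD2r ?ler_pM2l// ltW.
by move/le_trans; apply; lra.
Qed.

End PowerSums.

(** * Balls in the logarithmic plane *)

Section BallCovers.
Context {R : realType}.
Local Notation C := R[i].
Implicit Types (c z w : C) (r t y : R) (U : set C).
Local Open Scope complex_scope.

(** Balls in the logarithmic plane around points with real part at least y = ln M,
    up to the radius 1. Since only their exponential images matter, the centres are
    taken in a strip of height 2 pi, which makes the shifts by 2 pi i k of one ball
    comparable to |k|. *)
Definition good_ball y c r :=
  [/\ 0 <= r, r <= 1, y - 1 <= complex.Re c & `|complex.Im c| <= pi].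

Definition ball_weight t y U (v : \bar R) :=
  exists c r, [/\ good_ball y c r, U = cexp @` disc c r & v = (r `^ t)%:E].

Lemma disc0 c : disc c 0 = set0.
Proof. by rewrite -subset0 => z; rewrite /disc /= ltNge cabs_ge0. Qed.

Lemma ball_weight0 t y : t != 0 -> ball_weight t y set0 0%E.
Proof.
move=> t0; exists y%:C, 0; split; last by rewrite powR0.
  by split=> //=; rewrite ?normr0 ?pi_ge0// lerBlDr lerDl.
by rewrite disc0 image_set0.
Qed.

Lemma covered_ball t y c r : t != 0 -> good_ball y c r ->
  covered (ball_weight t y) (cexp @` disc c r) (r `^ t)%:E.
Proof.
move=> t0 cr; apply: covered1; first by rewrite lee_fin powR_ge0.
  by exists c, r.
exact: ball_weight0.
Qed.

(** Passing from the logarithmic plane to the z-plane costs a factor |e^w|, which is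
    bounded on bounded sets. *)
Lemma diameter_cexp_ball_le (K : R) c r : 0 <= r -> r <= 1 -> 0 <= K ->
  (diameter ((cexp @` disc c r) `&` [set z | (cabs z <= K)%R])
     <= (6 * expR 2 * K * r)%:E)%E.
Proof.
move=> r0 r1 K0; apply: ge_ereal_sup => _ [_ [[a ac <-] aK] [_ [[b bc <-] bK] <-]].
rewrite lee_fin; have ab : cabs (a - b) <= 2 * r.
  have := cabsD (a - c) (c - b); rewrite addrA subrK => /le_trans; apply.
  by move: ac bc; rewrite /disc /= (cabs_distC b); lra.
apply: le_trans (cabs_cexpB_le _) _; first by lra.
have -> : 6 * expR 2 * K * r = (3 * expR 2 * K) * (2 * r) by ring.
rewrite ler_pM ?mulr_ge0 ?expR_ge0 ?cabs_ge0//.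
by rewrite ler_wpM2l// mulr_ge0 ?expR_ge0.
Qed.

Lemma covered_diam_of_ball t y (K : R) U v : 0 < t -> 0 <= K ->
    ball_weight t y U v ->
  covered (diam_weight t) ([set z | cabs z <= K] `&` U)
    (((6 * expR 2 * K) `^ t)%:E * v)%E.
Proof.
move=> t0 K0 [c [r [[r0 r1 _ _] -> ->]]].
have B0 : 0 <= 6 * expR 2 * K by rewrite !mulr_ge0 ?expR_ge0.
rewrite -EFinM -powRM//; apply: covered1.
- by rewrite lee_fin powR_ge0.
- rewrite /diam_weight setIC; apply: diameter_pow_le; first exact: ltW.
  exact: diameter_cexp_ball_le.
- by rewrite /diam_weight /diameter_pow eqxx.
Qed.

(** The minimum keeps every centre in the strip, also for indices b that are too
    large to be of use. *)
Definition grid y (a b : nat) : C :=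
  (y + a%:R / 2) +i* Num.min pi (- pi + b%:R / 2).

Lemma good_grid y a b : good_ball y (grid y a b) 1.
Proof.
split=> //=.
  have : 0 <= (a%:R : R) / 2 by rewrite divr_ge0. lra.
rewrite ler_norml ge_min lexx le_min andbT.
have : 0 <= (b%:R : R) / 2 by rewrite divr_ge0.
by have := @pi_ge0 R; lra.
Qed.

(** The bound 16 is the number of steps of length 1/2 in the height 2 pi < 8. *)
Lemma mem_grid y (J : nat) z : expR y <= cabs z -> 2 * (ln (cabs z) - y) < J%:R ->
  exists a b, [/\ (a < J)%N, (b < 16)%N & (cexp @` disc (grid y a b) 1) z].
Proof.
move=> yz zJ; have z0 : z != 0.
  apply/eqP => z0; move: yz; rewrite z0 ComplexField.Normc.normc0.
  by rewrite leNgt expR_gt0.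
have [w wz w_pi] := exists_log z0.
have Rew : complex.Re w = ln (cabs z) by exact: Re_eq_ln_cabs.
have yw : y <= complex.Re w by rewrite Rew -[y]expRK ler_ln ?posrE ?expR_gt0 ?cabs_gt0.
have pi4 : (pi : R) < 4 by have := @pihalf_lt2 R; lra.
move: w_pi; rewrite ler_norml => /andP[Imw1 Imw2].
have A0 : 0 <= 2 * (complex.Re w - y) by lra.
have B0 : 0 <= 2 * (complex.Im w + pi) by lra.
have /andP[] := truncn_itv A0; set a := Num.truncn _ => a1 a2.
have /andP[] := truncn_itv B0; set b := Num.truncn _ => b1 b2.
exists a, b; split.
- by rewrite -(ltr_nat R) (le_lt_trans a1)// Rew.
- by rewrite -(ltr_nat R) (le_lt_trans b1)//; lra.
exists w => //; rewrite /disc /=; apply: le_lt_trans (cabs_le_ReIm _) _.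
rewrite ReB ImB /= min_r; last by lra.
move: a2 b2; rewrite -[a.+1%:R]natr1 -[b.+1%:R]natr1 => a2 b2.
have h1 : `|complex.Re w - (y + a%:R / 2)| < 1 / 2 by rewrite ltr_norml; lra.
have h2 : `|complex.Im w - (- pi + b%:R / 2)| < 1 / 2 by rewrite ltr_norml; lra.
by lra.
Qed.

(** The annulus M <= |z| <= K is compact, so that finitely many good balls suffice;
    J counts them, and depends only on K. *)
Lemma covered_preimage_annulus t y (K : R) : 0 < t ->
  exists J : nat, forall (q : R) (E : set C) (g : C -> C), 0 <= q ->
    (forall z, E z -> expR y <= cabs (g z)) ->
    (forall c r, good_ball y c r ->
      covered (ball_weight t y) (E `&` g @^-1` (cexp @` disc c r)) (q * r `^ t)%:E) ->
  covered (ball_weight t y) (E `&` g @^-1` [set z | cabs z <= K]) (J%:R * q)%:E.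
Proof.
move=> t0; pose J := Num.bound `|2 * (ln K - y)|.
exists (J * 16)%N => q E g q0 Eg Eq.
have cov a b : covered (ball_weight t y)
    (E `&` g @^-1` (cexp @` disc (grid y a b) 1)) q%:E.
  by have := Eq _ _ (good_grid y a b); rewrite powR1 mulr1.
have P0 := @ball_weight0 t y (lt0r_neq0 t0).
rewrite natrM -mulrA EFinM.
apply: (covered_bigcup_ord (Y := fun a => \bigcup_(b < 16)
  (E `&` g @^-1` (cexp @` disc (grid y a b) 1)))) => //.
- by rewrite lee_fin mulr_ge0.
- move=> z [Ez gz]; have gy := Eg _ Ez.
  have [|a [b [aJ b16 zab]]] := @mem_grid y J (g z) gy.
    apply: le_lt_trans (_ : `|2 * (ln K - y)| < _); last exact: archi_boundP (normr_ge0 _).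
    apply: le_trans (ler_norm _); rewrite ler_pM2l// lerD2r ler_ln ?posrE//.
      exact: lt_le_trans (expR_gt0 _) gy.
    exact: lt_le_trans (lt_le_trans (expR_gt0 _) gy) gz.
  by exists a => //; exists b.
- move=> a _; rewrite EFinM.
  apply: (covered_bigcup_ord (Y := fun b => E `&` g @^-1` (cexp @` disc (grid y a b) 1))) => //.
Qed.

End BallCovers.

(** * Pulling back covers along the dynamics *)

Definition orbit_ge (R : realType) (f : R[i] -> R[i]) (M : R) : set R[i] :=
  [set z | forall n, M <= cabs (iter n f z)].

Definition bounded_return (R : realType) (f : R[i] -> R[i]) (M : R) (K n : nat) :
    set R[i] :=
  orbit_ge f M `&` [set z | cabs z <= K%:R] `&` [set z | cabs (iter n f z) <= K%:R].

(** The estimate is carried out at the logarithmic scale y = ln M. The Lipschitz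
    argument needs room between the half-planes of ln R0 and y, and y > 4 / beta makes
    the branches contract. *)
Section Dynamics.
Context {R : realType}.
Local Notation C := R[i].
Context (f F : C -> C) (N : nat) (R0 beta t y : R).
Context (F_log : logarithmic_transform f R0 F)
  (F_bound : derivative_bound f R0 F beta (ln R0))
  (beta_gt0 : 0 < beta) (t_gt1 : 1 < t)
  (y_ge_R0 : ln R0 + 10 <= y) (y_ge_beta : 4 / beta + 10 <= y).
Local Open Scope complex_scope.

Let y10 : 10 <= y.
Proof. by apply: le_trans y_ge_beta; rewrite lerDr divr_ge0// ltW. Qed.

Let t_neq0 : t != 0. Proof. by rewrite lt0r_neq0// (lt_trans ltr01). Qed.

(** Both the real part of c and |k| bound the modulus of c + 2 pi i k from below; the
    factor 4 absorbs the replacement of the maximum of the two by their sum and of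
    c + 2 pi i k by any point at distance less than 1 from it. *)
Lemma segment_to_turn_gt (c p : C) (r : R) (k : int) (s : R) :
    good_ball y c r -> cabs (p - (c + turn k)) < 1 -> 0 <= s <= 1 ->
  complex.Re c + `|k|%N%:R <
    4 * cabs (p + s%:C * ((c + turn k) - p)).
Proof.
move=> [r0 r1 cy cpi] pc /andP[s0 s1]; set u := c + turn k in pc *.
have uRe : complex.Re c <= cabs u.
  by apply: le_trans (ler_norm _) _; have := normr_Re_le u; rewrite ReD /= addr0.
have uIm : 2 * `|k|%N%:R <= cabs u.
  have [->|k0] := eqVneq k 0; first by rewrite mulr0 cabs_ge0.
  apply: le_trans (normr_Im_le u); rewrite ImD /=.
  have k1 : 1 <= `|k|%N%:R :> R by rewrite ler1n absz_gt0.
  have pi2 := @pi_ge2 R.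
  have kpi : `|k%:~R * (pi *+ 2) : R| = `|k|%N%:R * (pi *+ 2).
    have pi2_ge0 : 0 <= (pi : R) *+ 2 by rewrite mulrn_wge0// pi_ge0.
    by rewrite normrM -intr_norm -natr_absz (ger0_norm pi2_ge0).
  have := ler_normD (complex.Im c + k%:~R * (pi *+ 2)) (- complex.Im c).
  rewrite addrAC subrr add0r normrN kpi.
  have h : `|k|%N%:R * 2 + `|k|%N%:R * pi <= (`|k|%N%:R : R) * pi *+ 2.
    by rewrite [leRHS]mulr2n lerD2r ler_wpM2l.
  have h2 : pi <= (`|k|%N%:R : R) * pi by rewrite ler_peMl// pi_ge0.
  by move: h h2; rewrite -mulrnAr mulr2n mulrDr; lra.
have us : cabs u - 1 < cabs (p + s%:C * (u - p)).
  have := cabs_sub_le u (u - (p + s%:C * (u - p))).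
  have -> : u - (u - (p + s%:C * (u - p))) = p + s%:C * (u - p) by ring.
  have -> : u - (p + s%:C * (u - p)) = (1 - s)%:C * (u - p).
    by rewrite rmorphB /=; ring.
  rewrite cabsM cabs_real ger0_norm ?subr_ge0// (cabs_distC u p).
  have : (1 - s) * cabs (p - u) <= cabs (p - u).
    by rewrite ler_piMl ?cabs_ge0//; lra.
  by move: pc; lra.
by move: us uRe uIm cy y10; lra.
Qed.

(** The preimage of a good ball under one inverse branch, composed with one period,
    lies in one good ball: the branch is a contraction on the translated ball, and
    the image ball can be moved by a period back to the strip. If no point of the
    orbits under consideration falls into the ball, the set is empty and nothing
    is known about the branch. *)
Lemma covered_branch_preimage (W : set C) (c : C) (r : R) (k : int) :
    components (log_domain f R0) W -> good_ball y c r ->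
  covered (ball_weight t y)
    [set z | exists w, [/\ W w, cexp w = z, y <= complex.Re w,
       y <= complex.Re (F w) & disc c r (F w - turn k)]]
    ((4 / (beta * (complex.Re c + `|k|%N%:R)) * r) `^ t)%:E.
Proof.
move=> W_comp cr; set X := [set z | _]; set L := 4 / _.
have [r0 r1 cy cpi] := cr.
have x0 : 0 < complex.Re c + `|k|%N%:R by rewrite ltr_wpDr//; move: cy y10; lra.
have L0 : 0 < L by rewrite divr_gt0// mulr_gt0.
have L1 : L <= 1.
  rewrite ler_pdivrMr ?mulr_gt0// mul1r mulrC -ler_pdivrMr//.
  have := ler0n R `|k|; move: y_ge_beta cy; move: (4 / beta) => b; lra.
have [F_hol _ /(_ _ W_comp)[_ [F_W _ _] [G [G_hol GW GF FG]]] _] := F_log.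
have W_sub w : W w -> log_domain f R0 w.
  by have [w0 _ <-] := W_comp; exact: connected_component_sub.
pose u := c + turn k.
(* Each orbit point w is a safe starting point for following the branch to the
   translated centre u. *)
have contr w : W w -> y <= complex.Re w -> y <= complex.Re (F w) ->
    disc c r (F w - turn k) -> cabs (G u - w) <= L * cabs (u - F w) /\ cabs (u - F w) < r.
  move=> Ww yw yFw; rewrite /disc /= -addrA -opprD [turn k + c]addrC -/u => Fu.
  have Fu1 : cabs (F w - u) < 1 by exact: lt_le_trans r1.
  split; last by rewrite cabs_distC.
  rewrite -{1}(GF _ Ww); apply: (inverse_branch_lipschitz (r0 := ln R0) beta_gt0 L0 G_hol FG).
  - by move=> z Hz; apply: F_hol; apply/W_sub/GW.
  - by move=> z Hz HGz; rewrite -{1}(FG _ Hz); apply: F_bound => //; apply/W_sub/GW.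
  - exact: F_W.
  - by rewrite /half_plane /= /u ReD /= addr0; move: cy y10 y_ge_R0; lra.
  - move=> s s01; rewrite /L mulrA mulrAC invfM mulrA.
    have := segment_to_turn_gt cr Fu1 s01; rewrite -/u.
    set q := cabs _ => q4.
    rewrite [ltRHS](_ : _ = 4 * q / (complex.Re c + `|k|%N%:R)); last first.
      by field; rewrite !lt0r_neq0.
    by rewrite ltr_pdivlMr// mul1r.
  - rewrite GF// cabs_distC.
    have : L * cabs (F w - u) <= 1 by rewrite -[leRHS]mul1r ler_pM ?cabs_ge0// ltW.
    by move: y_ge_R0 yw; move: (L * _) => q; lra.
have [[z0 [w0 [Ww0 _ yw0 yFw0 Fw0]]]|/nonemptyPn X0] := pselect (X !=set0); last first.
  have P0 := ball_weight0 y t_neq0.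
  apply: (@sub_covered _ _ _ set0 _ 0%E); last exact: covered1.
    by rewrite X0.
  by rewrite lee_fin powR_ge0.
have [j Gj] := exists_turn_Im (G u).
apply: (@sub_covered _ _ _ (cexp @` disc (G u - turn j) (L * r)) _ ((L * r) `^ t)%:E) => //.
  move=> z [w [Ww <- yw yFw Fw]]; exists (w - turn j).
    have [h1 h2] := contr _ Ww yw yFw Fw.
    rewrite /disc /= opprB addrA subrK cabs_distC; apply: le_lt_trans h1 _.
    by rewrite ltr_pM2l.
  by rewrite -turnN cexpD_turn.
apply: covered_ball => //; split=> //.
- by rewrite mulr_ge0// ltW.
- by rewrite -[leRHS]mul1r ler_pM// ltW.
- have [h1 h2] := contr _ Ww0 yw0 yFw0 Fw0.
  have h3 := normr_Re_le (G u - w0).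
  have h4 : L * cabs (u - F w0) <= 1.
    by rewrite -[leRHS]mul1r ler_pM ?cabs_ge0 ?(ltW L0)// (le_trans (ltW h2)).
  have h5 := ler_norm (- complex.Re (G u - w0)).
  move: h1 h3 h4 h5 yw0; rewrite normrN !ReB /= subr0.
  by move: (L * _) => q; lra.
Qed.

Context (W : nat -> set C) (R0_gt0 : 0 < R0) (t_le2 : t <= 2)
  (W_comp : forall i, (i < N)%N -> components (log_domain f R0) (W i))
  (W_cover : tract_domain f R0 `<=` \bigcup_(i < N) cexp @` W i)
  (y_ge_N : 10 * (4 `^ t * N%:R / ((t - 1) * beta `^ t)) <= y `^ (t - 1)).

(** The inverse branches are indexed by a tract and an integer k, the latter being
    listed as n and -n for n = |k|; the case n = 0 is counted twice. *)
Lemma preimage_ball_sub c r :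
  [set z | expR y <= cabs z /\ expR y <= cabs (f z)] `&` f @^-1` (cexp @` disc c r)
  `<=` \bigcup_n \bigcup_(i < N) \bigcup_(j < 2)
    [set z | exists w, [/\ W i w, cexp w = z, y <= complex.Re w, y <= complex.Re (F w)
       & disc c r (F w - turn (if j == 0%N then n%:Z else - n%:Z))]].
Proof.
move=> z [[yz yfz] [p cp pz]].
have R0_lt : R0 < cabs (f z).
  apply: lt_le_trans yfz; rewrite -[R0]lnK ?posrE// ltr_expR.
  by move: y_ge_R0; lra.
have [i iN [w Ww wz]] := W_cover R0_lt.
have w_dom : log_domain f R0 w.
  by rewrite /log_domain /tract_domain /ext_disc /= wz.
have [_ _ _ /(_ _ w_dom) Fw] := F_log.
have yw : y <= complex.Re w.
  rewrite -[y]expRK (Re_eq_ln_cabs wz).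
  by rewrite ler_ln ?posrE ?expR_gt0// (lt_le_trans (expR_gt0 _) yz).
have yFw : y <= complex.Re (F w).
  rewrite wz in Fw; rewrite -[y]expRK (Re_eq_ln_cabs Fw).
  by rewrite ler_ln ?posrE ?expR_gt0// (lt_le_trans (expR_gt0 _) yfz).
have [k Fk] : exists k, F w = p + turn k by apply: cexp_eq; rewrite Fw wz pz.
exists `|k|%N => //; exists i => //; exists (if 0 <= k then 0%N else 1%N).
  by case: ifP.
exists w; split=> //; rewrite Fk (_ : (if _ then _ else _) = k) ?addrK//.
by case: (k) => n /=; rewrite ?NegzE// abszN.
Qed.

(** The transfer estimate: the sum over all inverse branches of the t-th powers of
    their contraction factors is at most 1/2. *)
Lemma covered_preimage_ball c r : good_ball y c r ->
  covered (ball_weight t y)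
    ([set z | expR y <= cabs z /\ expR y <= cabs (f z)] `&` f @^-1` (cexp @` disc c r))
    (2^-1 * r `^ t)%:E.
Proof.
move=> cr; have [r0 r1 cy _] := cr.
pose x := complex.Re c.
have x0 : 0 < x by move: cy y10; rewrite -/x; lra.
pose a n : R := (4 / (beta * (x + n%:R)) * r) `^ t.
have aE n : a n = (4 `^ t / beta `^ t * r `^ t) * (x + n%:R) `^ (- t).
  have xn : 0 < x + n%:R by rewrite ltr_wpDr.
  have bx : 0 <= beta * (x + n%:R) by rewrite ltW// mulr_gt0.
  rewrite /a powRM ?divr_ge0// powRM ?invr_ge0// -powR_inv1// -powRrM mulN1r powRN.
  rewrite powRM ?ltW// !powRN; field.
  by rewrite !lt0r_neq0 ?powR_gt0.
apply: (sub_covered (preimage_ball_sub (c := c) (r := r)) _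
  (covered_bigcup (s := fun n => (N%:R%:E * (2%:R%:E * (a n)%:E))%E) (fun z Xz => Xz) _)).
- pose A := 4 `^ t * N%:R / ((t - 1) * beta `^ t).
  have bt : 0 < beta `^ t by exact: powR_gt0.
  have t1 : 0 < t - 1 by rewrite subr_gt0.
  have A0 : 0 <= A by rewrite divr_ge0 ?mulr_ge0 ?powR_ge0// ltW.
  rewrite (eq_eseriesr (g := fun n =>
    ((2 * A * (t - 1) * r `^ t)%:E * ((x + n%:R) `^ (- t))%:E)%E)).
    rewrite nneseriesZl; last by move=> n _; rewrite lee_fin powR_ge0.
    apply: le_trans (lee_wpmul2l _ (nneseries_powRN_le x0 t_gt1)) _.
      by rewrite lee_fin mulr_ge0 ?powR_ge0// mulr_ge0 ?(ltW t1)// mulr_ge0.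
    rewrite -EFinM lee_fin mulrAC ler_wpM2r ?powR_ge0//.
    exact: branch_sum_le y_ge_N.
  move=> n _; rewrite aE -!EFinM; congr EFin; rewrite /A; field.
  by rewrite !lt0r_neq0.
- move=> n; have a0 : (0 <= (a n)%:E)%E by rewrite lee_fin powR_ge0.
  have P0 := ball_weight0 y t_neq0.
  apply: (covered_bigcup_ord (Y := fun i => \bigcup_(j < 2) [set z | exists w,
    [/\ W i w, cexp w = z, y <= complex.Re w, y <= complex.Re (F w)
       & disc c r (F w - turn (if j == 0%N then n%:Z else - n%:Z))]])) => //.
    by rewrite mule_ge0// lee_fin.
  move=> i iN.
  apply: (covered_bigcup_ord (Y := fun j => [set z | exists w,
    [/\ W i w, cexp w = z, y <= complex.Re w, y <= complex.Re (F w)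
       & disc c r (F w - turn (if j == 0%N then n%:Z else - n%:Z))]])) => //.
  move=> j _; have := covered_branch_preimage (if j == 0%N then n%:Z else - n%:Z) (W_comp iN) cr.
  by rewrite -/x; case: ifP => _; rewrite ?abszN.
Qed.

Let E := orbit_ge f (expR y).

(** Hence the weight of the n-th preimages decays geometrically. *)
Lemma covered_iter_preimage_ball n c r : good_ball y c r ->
  covered (ball_weight t y) (E `&` iter n f @^-1` (cexp @` disc c r))
    ((2^-1) ^+ n * r `^ t)%:E.
Proof.
elim: n c r => [|n IHn] c r cr.
  rewrite expr0 mul1r.
  by apply: sub_covered (covered_ball t_neq0 cr) => // z [].
have q0 : 0 <= (2^-1 : R) ^+ n by rewrite exprn_ge0.
have step U v : (0 <= v)%E -> ball_weight t y U v ->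
    covered (ball_weight t y) (E `&` iter n f @^-1` U) ((2^-1 ^+ n)%:E * v)%E.
  by move=> _ [c' [r' [cr' -> ->]]]; rewrite -EFinM; exact: IHn.
apply: sub_covered (covered_preimage q0 step (covered_preimage_ball cr)).
  move=> z [Ez fz]; split=> //; split; last exact: fz.
  by split; [exact: Ez|exact: (Ez n.+1)].
by rewrite -EFinM mulrA -exprSr.
Qed.

(** Points which return to a fixed annulus at arbitrarily late times lie, for every
    m, in the union over n >= m of the n-th preimages of finitely many balls, whose
    total weight is a tail of a geometric series. *)
Lemma hausdorff_null_returns (K : nat) :
  hausdorff_null t (\bigcap_m \bigcup_n bounded_return f (expR y) K (m + n)).
Proof.
have t0 : 0 < t by rewrite (lt_trans ltr01).
have [J HJ] := covered_preimage_annulus y K%:R t0.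
pose B := (6 * expR 2 * K%:R) `^ t.
have B0 : 0 <= B by exact: powR_ge0.
have cov n : covered (diam_weight t) (bounded_return f (expR y) K n) (B * (J%:R * 2^-1 ^+ n))%:E.
  have q0 : 0 <= (2^-1 : R) ^+ n by rewrite exprn_ge0.
  have := HJ _ E (iter n f) q0 (fun z Ez => Ez n) (@covered_iter_preimage_ball n).
  have step U v : (0 <= v)%E -> ball_weight t y U v ->
      covered (diam_weight t) ([set z | cabs z <= K%:R] `&` id @^-1` U) (B%:E * v)%E.
    by move=> _; exact: covered_diam_of_ball.
  move=> /(covered_preimage B0 step); rewrite EFinM; apply: sub_covered => //.
  by move=> z [[Ez zK] fz].
move=> e e0.
pose S := 2 * (B * J%:R); have S0 : 0 <= S by rewrite !mulr_ge0.
(* S / 2^m is the tail: the sum over n of B J / 2^(m + n). *)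
pose m := Num.bound (S / e).
have mP : S / 2 ^+ m <= e.
  have := archi_boundP (divr_ge0 S0 (ltW e0)); rewrite -/m ltr_pdivrMr// => Sm.
  rewrite ler_pdivrMr ?exprn_gt0// mulrC; apply: le_trans (ltW Sm) _.
  by rewrite ler_pM2r// -natrX ler_nat ltnW// ltn_expl.
apply: (@sub_covered _ _ _ (\bigcup_n bounded_return f (expR y) K (m + n)) _ _ e%:E _ _
  (covered_bigcup (fun z Xz => Xz) (fun n => cov (m + n)%N))).
  by move=> z /(_ m I).
apply: (le_trans (y := (S / 2 ^+ m)%:E)); last by rewrite lee_fin.
apply: le_trans (epsilon_trick0 xpredT _); last by rewrite divr_ge0// exprn_ge0.
rewrite le_eqVlt; apply/orP; left; apply/eqP; apply: eq_eseriesr => n _; congr EFin.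
have p2 k : (2 : R) ^+ k != 0 by rewrite expf_neq0// pnatr_eq0.
have -> : (2 ^ n.+1)%:R = 2 * 2 ^+ n :> R by rewrite expnS natrM natrX.
move: (p2 m) (p2 n); rewrite exprVn exprD /S.
by move: (2 ^+ m) (2 ^+ n) => a b a0 b0; field; rewrite a0 b0.
Qed.

Lemma hausdorff_dim_nonescaping_le (A : set C) :
  A `<=` orbit_ge f (expR y) `\` escaping_set f -> (hausdorff_dim A <= t%:E)%E.
Proof.
move=> A_sub; apply: hausdorff_dim_le; first by rewrite (lt_trans ltr01).
apply: sub_hausdorff_null (hausdorff_null_bigcup hausdorff_null_returns).
move=> z /A_sub[Ez /= /cvgryPge nesc].
have [a nA] : exists a : R, ~ \forall n \near \oo, a <= cabs (iter n f z).
  by apply: contrapT => h; apply: nesc => a; apply: contrapT => nA; apply: h; exists a.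
pose K := Num.bound (`|a| + cabs z).
have KP : `|a| + cabs z < K%:R by apply: archi_boundP; rewrite addr_ge0// cabs_ge0.
exists K => // m _; apply: contrapT => none; apply: nA; exists m => // n /= mn.
rewrite leNgt; apply/negP => nA; apply: none; exists (n - m)%N => //.
rewrite subnKC//; split; first split=> //.
  by apply: ltW; apply: le_lt_trans KP; rewrite lerDr.
rewrite /=; apply: ltW; apply: lt_trans nA _; apply: le_lt_trans KP.
by rewrite (le_trans (ler_norm _))// lerDl cabs_ge0.
Qed.

End Dynamics.

(** * The dimension bound *)

Theorem theorem1p2 (R : realType) (f F : R[i] -> R[i]) (N : nat)
    (R0 beta t M : R)
    (f_B : class_B f)
    (f_regular : regular_logarithmic_transform f)
    (R0_ge1 : 1 <= R0)
    (R0_admissible : admissible_radius f R0)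
    (N_tracts : (tracts f R0 #= `I_N)%card)
    (F_log_transform : logarithmic_transform f R0 F)
    (beta_gt0 : 0 < beta)
    (F_bound : derivative_bound f R0 F beta (ln R0))
    (t_gt1 : 1 < t) (t_le2 : t <= 2)
    (M_ge : Num.max
       (expR (5 * pi) * Num.max R0 (expR (4 / beta)))
       (expR ((10 * 4 `^ t * N%:R / ((t - 1) * beta `^ t)) `^ (t - 1)^-1))
      <= M) :
  (hausdorff_dim (julia_ge f M `\` escaping_set f) <= t%:E)%E.
Proof.
move: M_ge; rewrite ge_max => /andP[M_R M_N].
have R0_gt0 : 0 < R0 by exact: lt_le_trans R0_ge1.
have M_R0 : expR (5 * pi) * R0 <= M.
  by apply: le_trans M_R; rewrite ler_pM2l ?expR_gt0// le_max lexx.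
have M_beta : expR (5 * pi) * expR (4 / beta) <= M.
  by apply: le_trans M_R; rewrite ler_pM2l ?expR_gt0// le_max lexx orbT.
have M_gt0 : 0 < M by apply: lt_le_trans M_R0; rewrite mulr_gt0 ?expR_gt0.
have MK : expR (ln M) = M by rewrite lnK.
have pi5 : 10 <= 5 * (pi : R) by have := @pi_ge2 R; lra.
have y_R0 : ln R0 + 10 <= ln M.
  have : expR (5 * pi + ln R0) <= expR (ln M) by rewrite expRD lnK ?posrE// MK.
  by rewrite ler_expR; lra.
have y_beta : 4 / beta + 10 <= ln M.
  have : expR (5 * pi + 4 / beta) <= expR (ln M) by rewrite expRD MK.
  by rewrite ler_expR; move: (4 / beta) => b; lra.
have s_gt0 : 0 < t - 1 by rewrite subr_gt0.
have y_N : 10 * (4 `^ t * N%:R / ((t - 1) * beta `^ t)) <= ln M `^ (t - 1).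
  have {}M_N : (10 * 4 `^ t * N%:R / ((t - 1) * beta `^ t)) `^ (t - 1)^-1 <= ln M.
    by rewrite -ler_expR MK.
  have X0 : 0 <= 10 * 4 `^ t * N%:R / ((t - 1) * beta `^ t).
    by rewrite divr_ge0 ?mulr_ge0 ?powR_ge0// ltW.
  rewrite !mulrA in X0 M_N *.
  move: X0 M_N; set X := _ / _ => X0 M_N.
  have -> : X = (X `^ (t - 1)^-1) `^ (t - 1).
    by rewrite -powRrM mulVf ?powRr1// lt0r_neq0.
  apply: ge0_ler_powR => //; rewrite ?nnegrE ?powR_ge0 ?(ltW s_gt0)//.
  exact: le_trans (powR_ge0 _ _) M_N.
have f_entire : entire f by have [[]] := f_B.
have V_open : open (tract_domain f R0).
  apply: open_comp => [z _|]; first exact/derivable_continuous/f_entire.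
  apply/open_discP => z; rewrite /ext_disc /= => zR.
  exists (cabs z - R0) => [|w]; first by rewrite subr_gt0.
  by have := cabs_sub_le z w; rewrite /disc /= cabs_distC; lra.
have V_0 : ~ tract_domain f R0 0.
  have /R0_admissible : (closure (sing_inv f) `|` [set f 0]) (f 0) by right.
  rewrite /disc /tract_domain /ext_disc /= subr0 => f0.
  by move/lt_trans => /(_ _ f0); rewrite ltxx.
have [W [W_comp W_cover]] := enum_log_components V_open V_0 N_tracts.
apply: (hausdorff_dim_nonescaping_le F_log_transform F_bound beta_gt0 t_gt1
  y_R0 y_beta R0_gt0 t_le2 W_comp W_cover y_N).
by rewrite MK => z [[_ Mz] nesc].
Qed.
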